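(* Let $\eta=(\eta_1,\dots,\eta_r)$ be a composition of $n$. Then $$\sum_{\sigma\in S^{\eta}} x^{\operatorname{den}(\sigma)}\,y^{\operatorname{iexc}(\sigma)}=\sum_{w\in S_{\eta}} x^{\operatorname{den}_H(w)}\,y^{\operatorname{exc}(w)}.$$
   Context: Write $[n]=\{1,\dots,n\}$. Multiset permutations: $S_\eta$ is the set of all words of length $n$ that are rearrangements of the trivial word $\mathrm{id}=1^{\eta_1}2^{\eta_2}\cdots r^{\eta_r}$ ($\eta_1$ copies of $1$, then $\eta_2$ copies of $2$, etc.). For $w=w_1\cdots w_n\in S_\eta$: - $\operatorname{Exc}(w)=\{i\in[n]: w_i>\mathrm{id}_i\}$ and $\operatorname{exc}(w)=|\operatorname{Exc}(w)|$. - If $\operatorname{Exc}(w)=\{i_1<\dots<i_k\}$, the exceeding subword is $E(w)=w_{i_1}\cdots w_{i_k}$; if $[n]\setminus\operatorname{Exc}(w)=\{j_1<\dots<j_{n-k}\}$, the non-exceeding subword is $N(w)=w_{j_1}\cdots w_{j_{n-k}}$. - For a word $u=u_1\cdots u_m$, $\operatorname{inv}(u)=|\{(i,j):i<j,\ u_i>u_j\}|$ and $\operatorname{imv}(u)=|\{(i,j):i<j,\ u_i\ge u_j\}|$. - $\operatorname{den}_H(w)=\sum_{i\in\operatorname{Exc}(w)} i+\operatorname{imv}(E(w))+\operatorname{inv}(N(w))$. Admissible permutations: the block map $\pi_\eta:[n]\to[r]$ sends $i$ to the unique $k$ with $\sum_{l<k}\eta_l<i\le\sum_{l\le k}\eta_l$.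 A permutation $\sigma\in S_n$ is $\eta$-admissible if $\sigma(i)<\sigma(j)$ whenever $i<j$ and $\pi_\eta(i)=\pi_\eta(j)$; $S^\eta$ denotes the set of $\eta$-admissible permutations. For $\sigma\in S_n$: - $I_\sigma=\{j\in[n]:\pi_\eta(\sigma^{-1}(j))>\pi_\eta(j)\}$ and $\operatorname{iexc}(\sigma)=|I_\sigma|$. - $N^+_\sigma=\{(i,j)\in[n]^2:\pi_\eta(i)\le\pi_\eta(j),\ \sigma(i)<j,\ \sigma^{-1}(j)<i\}$. - $N^-_\sigma=\{(i,j)\in[n]^2:\pi_\eta(i)>\pi_\eta(j),\ \sigma(i)<j,\ \sigma^{-1}(j)>i\}$. - $\operatorname{den}(\sigma)=\sum_{j\in I_\sigma} j+|N^+_\sigma|-|N^-_\sigma|-\operatorname{iexc}(\sigma)$. *)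

(* Defs.v *)
From mathcomp Require Import all_boot all_order all_fingroup all_algebra.

Set Implicit Arguments.
Unset Strict Implicit.
Unset Printing Implicit Defensive.

Import GRing.Theory.

(* Throughout, the element k of [n] = {1, ..., n} is represented by the        *)
(* ordinal k - 1 of 'I_n; only its numerical value needs the shift .+1.        *)
(* Letters of words and block numbers are the natural numbers 1, ..., r.       *)

Definition is_composition (n : nat) (eta : seq nat) : bool :=
  all (leq 1) eta && (sumn eta == n).

Definition inv (u : seq nat) : nat :=
  #|[set p : 'I_(size u) * 'I_(size u) |
      (p.1 < p.2) && (nth 0 u p.2 < nth 0 u p.1)]|.

Definition imv (u : seq nat) : nat :=
  #|[set p : 'I_(size u) * 'I_(size u) |
      (p.1 < p.2) && (nth 0 u p.2 <= nth 0 u p.1)]|.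

Definition idword (eta : seq nat) : seq nat :=
  flatten [seq nseq (nth 0 eta k) k.+1 | k <- iota 0 (size eta)].

(* A duplicate-free enumeration of the rearrangements of idword eta. *)
Definition multiset_perms (eta : seq nat) : seq (seq nat) :=
  permutations (idword eta).

Section Words.

Variables (n : nat) (eta : seq nat).

Definition Exc (w : seq nat) : {set 'I_n} :=
  [set i : 'I_n | nth 0 (idword eta) i < nth 0 w i].

Definition exc (w : seq nat) : nat := #|Exc w|.

(* enum lists a set of ordinals in increasing order. *)
Definition subword (w : seq nat) (A : {set 'I_n}) : seq nat :=
  [seq nth 0 w i | i : 'I_n <- enum A].

Definition excword (w : seq nat) : seq nat := subword w (Exc w).
Definition nexcword (w : seq nat) : seq nat := subword w (~: Exc w).

Definition denH (w : seq nat) : nat :=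
  \sum_(i in Exc w) i.+1 + imv (excword w) + inv (nexcword w).

End Words.

(* reshape_index numbers both positions and blocks from 0; see blockP. *)
Definition block (eta : seq nat) (i : nat) : nat := (reshape_index eta i).+1.

Lemma blockP (eta : seq nat) (i : nat) : i < sumn eta ->
  [/\ 1 <= block eta i <= size eta,
      sumn (take (block eta i).-1 eta) < i.+1
    & i.+1 <= sumn (take (block eta i) eta)].
Proof.
move=> lt_i; have lt_r := reshape_indexP lt_i.
have lt_o := reshape_offsetP lt_i; have Di := reshape_indexK eta i.
rewrite /block /=; split; first exact: lt_r.
  by rewrite ltnS -{2}Di /flatten_index leq_addr.
rewrite (take_nth 0 lt_r) -cats1 sumn_cat /= addn0 -{1}Di /flatten_index.
by rewrite ltn_add2l.
Qed.

Section Permutations.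

Variables (n : nat) (eta : seq nat).

Definition admissible (s : 'S_n) : bool :=
  [forall i : 'I_n, forall j : 'I_n,
    (i < j) && (block eta i == block eta j) ==> (s i < s j)].

Definition Iset (s : 'S_n) : {set 'I_n} :=
  [set j : 'I_n | block eta j < block eta ((s^-1)%g j)].

Definition iexc (s : 'S_n) : nat := #|Iset s|.

Definition Nplus (s : 'S_n) : {set 'I_n * 'I_n} :=
  [set p : 'I_n * 'I_n |
    [&& block eta p.1 <= block eta p.2, s p.1 < p.2 & (s^-1)%g p.2 < p.1]].

Definition Nminus (s : 'S_n) : {set 'I_n * 'I_n} :=
  [set p : 'I_n * 'I_n |
    [&& block eta p.2 < block eta p.1, s p.1 < p.2 & p.1 < (s^-1)%g p.2]].

(* A difference, hence not nonnegative by construction: x ^ den s is a Laurent *)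
(* monomial, to be evaluated at a unit x.                                      *)
Definition den (s : 'S_n) : int :=
  ((\sum_(j in Iset s) j.+1)%N%:Z + #|Nplus s|%:Z - #|Nminus s|%:Z
     - (iexc s)%:Z)%R.

End Permutations.

(* Main.v *)
(* Send an admissible s to the word w with w_j = block (s^-1 j). Since s is    *)
(* increasing on blocks, s^-1 is the standardization of w, so this is a        *)
(* bijection onto the rearrangements of d = id, and it is weight preserving.   *)
(* Substituting i = s^-1 a, the sets N^+ and N^- become                        *)
(*   {a < j : w_j < w_a <= d_j}  and  {a < j : d_j < w_a <= w_j}.              *)
(* The pairs of N^+ with a non-exceeding a are the inversions of N(w). For an  *)
(* exceeding a, w being a rearrangement of d gives, with c = w_a,              *)
(*   #{j : w_j < c <= d_j} = #{j : d_j < c <= w_j},                            *)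
(* and on the right j > a contributes to N^-, j = a counts the exceedance a,   *)
(* and j < a contributes to imv(E(w)).                                         *)

Require Import Defs.
From mathcomp Require Import all_boot all_order all_fingroup all_algebra.
From mathcomp Require Import zify.

Local Open Scope ring_scope.

(** The map [perm_word] takes [iexc] to [exc] and, on admissible permutations, [den] to [denH]
    ([exc_perm_word], [den_perm_word]); it hits every rearrangement exactly once
    ([perm_eq_perm_words]), so the sums agree term by term. The statistics match because a word and
    its increasing rearrangement have equally many letters below any threshold: this expresses |N^+|
    as |N^-| plus the excedances, [imv] of the exceeding subword and [inv] of the non-exceeding one
    ([Nplus_decomposition]). Bijectivity holds because s is recovered from its word by a stable sort
    of the positions ([admissible_sort], [perm_word_surj]). *)

Lemma card_pairs (I J : finType) (P : I -> J -> bool) :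
  #|[set p : I * J | P p.1 p.2]| = (\sum_i \sum_j P i j)%N.
Proof.
rewrite -sum1dep_card big_mkcond pair_bigA /=.
by apply: eq_bigr => p _; case: (P _ _).
Qed.

Lemma enum_val_ltn (n : nat) (A : {set 'I_n}) (i j : 'I_#|A|) :
  (enum_val i < enum_val j)%N = (i < j)%N.
Proof.
have tr : transitive (relpre (@nat_of_ord n) ltn) by move=> ? ? ?; apply: ltn_trans.
have sorted_enum : sorted (relpre (@nat_of_ord n) ltn) (enum A).
  have -> : enum A = filter (mem A) (enum 'I_n) by rewrite enumT; unlock enum_mem.
  by apply: sorted_filter => //; rewrite -sorted_map val_enum_ord iota_ltn_sorted.
have homo_val (k l : 'I_#|A|) : (k < l)%N -> (enum_val k < enum_val l)%N.
  rewrite [enum_val l](enum_val_nth (enum_val k)).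
  rewrite {1}[enum_val k](enum_val_nth (enum_val k)).
  by apply: (sorted_ltn_nth tr (enum_val k) sorted_enum); rewrite inE -cardE.
have [/homo_val//|/homo_val|/val_inj->] := ltngtP i j; last by rewrite ltnn.
by move=> /ltnW; rewrite leqNgt => /negPf.
Qed.

(** Enumerating a set of positions preserves their order, so pairs of the subword can be counted at
    their original positions. A general [e] covers both [inv] and [imv]. *)
Lemma card_subword_pairs (n : nat) (w : seq nat) (A : {set 'I_n})
    (e : rel nat) (u := subword w A) :
  #|[set p : 'I_(size u) * 'I_(size u) |
      (p.1 < p.2)%N && e (nth 0%N u p.1) (nth 0%N u p.2)]| =
  (\sum_(i in A) \sum_(j in A) ((i < j) && e (nth 0 w i) (nth 0 w j)))%N.
Proof.
have size_u : size u = #|A| by rewrite size_map -cardE.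
have nth_u (i : 'I_#|A|) : nth 0%N u i = nth 0%N w (enum_val i).
  by rewrite (nth_map (enum_val i)) -?cardE // -enum_val_nth.
rewrite (card_pairs _ _ (fun i j : 'I_(size u) =>
  (i < j)%N && e (nth 0%N u i) (nth 0%N u j))).
have sumA (F : 'I_n -> nat) :
    (\sum_(i in A) F i = \sum_(k < size u) F (enum_val (cast_ord size_u k)))%N.
  rewrite big_enum_val (reindex (cast_ord size_u)) //.
  by exists (cast_ord (esym size_u)) => k _; [exact: cast_ordK|exact: cast_ordKV].
rewrite sumA; apply: eq_bigr => i _; rewrite sumA; apply: eq_bigr => j _.
by rewrite enum_val_ltn -!nth_u.
Qed.

(** * Words with the same letters as a weakly increasing word *)

(** Adding the j with both [w j] and [d j] below c turns the two sides into the two equal counts. *)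
Lemma ltn_leq_count (n : nat) (w d : 'I_n -> nat) (c : nat) :
  (\sum_j (w j < c) = \sum_j (d j < c) ->
   \sum_j ((w j < c) && (c <= d j)) = \sum_j ((d j < c) && (c <= w j)))%N.
Proof.
move=> eq_wd; apply: (@addnI (\sum_j ((w j < c) && (d j < c)))%N).
rewrite -!big_split /=; transitivity (\sum_j (w j < c))%N; last rewrite eq_wd.
  by apply: eq_bigr => j _; case: (ltnP (w j) c); case: (ltnP (d j) c).
by apply: eq_bigr => j _; case: (ltnP (w j) c); case: (ltnP (d j) c).
Qed.

Section Equidistribution.

Variables (n : nat) (w d : 'I_n -> nat).
Hypothesis d_homo : forall i j : 'I_n, (i <= j)%N -> (d i <= d j)%N.
Hypothesis eq_wd : forall c, (\sum_j (w j < c) = \sum_j (d j < c))%N.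

Local Notation E := [set i | d i < w i]%N.

(** If a exceeds, monotonicity of d makes [a < j] automatic on the left; apply [ltn_leq_count] at
    [c = w a] and split by the position of j: any j < a with [w a <= w j] satisfies
    [d j <= d a < w a], so it exceeds too. If a does not exceed, every j > a has [w a <= d j], so
    the first sum on the right vanishes, and [w j < w a] makes j non-exceeding. *)
Lemma exceeding_pairs (a : 'I_n) :
  (\sum_(j < n) [&& a < j, w a <= d j & w j < w a] =
   \sum_(j < n) [&& a < j, d j < w a & w a <= w j] + (a \in E) +
   \sum_(j < n) [&& a \in E, j \in E, j < a & w a <= w j] +
   \sum_(j < n) [&& a \notin E, j \notin E, a < j & w j < w a])%N.
Proof.
have [exc_a|nexc_a] := ltnP (d a) (w a); rewrite inE.
  rewrite [X in (_ = _ + X)%N]big1 ?addn0; last by move=> j _; rewrite exc_a.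
  transitivity (\sum_j ((w j < w a) && (w a <= d j)))%N.
    apply: eq_bigr => j _; have [|le_ja] := ltnP a j; first by rewrite /= andbC.
    by rewrite [(w a <= _)%N]leqNgt (leq_ltn_trans (d_homo _ _ le_ja)) ?andbF.
  have -> : nat_of_bool (d a < w a)%N = (\sum_(j < n) (j == a))%N.
    by rewrite exc_a (bigD1 a) //= eqxx big1 // => j /negPf->.
  rewrite ltn_leq_count // -!big_split /=; apply: eq_bigr => j _.
  rewrite inE exc_a /= -val_eqE /=.
  have [/= ? | lt_ja | /val_inj<-] := ltngtP a j; first by rewrite andbF !addn0.
    have lt_d : (d j < w a)%N by apply: leq_ltn_trans (d_homo _ _ (ltnW lt_ja)) _.
    rewrite lt_d /=; case: (leqP (w a) (w j)) => [le_wa|_]; last by rewrite !andbF.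
    by rewrite (leq_trans lt_d le_wa).
  by rewrite exc_a leqnn andbF.
rewrite [(d a < w a)%N]ltnNge nexc_a /=.
rewrite [X in (_ = X + _ + _ + _)%N]big1 => [|j _]; last first.
  case: ltnP => //= /ltnW/d_homo le_aj.
  by rewrite ltnNge (leq_trans nexc_a le_aj).
rewrite [X in (_ = _ + X + _)%N]big1 // !add0n.
apply: eq_bigr => j _; rewrite inE -leqNgt.
case: ltnP => //= [/ltnW/d_homo le_aj|]; last by rewrite andbF.
have le_wd := leq_trans nexc_a le_aj; rewrite le_wd /=.
by case: ltnP => [/ltnW/leq_trans->|]; rewrite ?andbF.
Qed.

Lemma Nplus_decomposition :
  (\sum_(a < n) \sum_(j < n) [&& a < j, w a <= d j & w j < w a] =
   \sum_(a < n) \sum_(j < n) [&& a < j, d j < w a & w a <= w j] + #|E| +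
   \sum_(a in E) \sum_(j in E) ((a < j) && (w j <= w a)) +
   \sum_(a in ~: E) \sum_(j in ~: E) ((a < j) && (w j < w a)))%N.
Proof.
rewrite (eq_bigr _ (fun a _ => exceeding_pairs a)) !big_split /=.
congr (_ + _ + _ + _)%N.
- by rewrite -sum1_card [RHS]big_mkcond; apply: eq_bigr => a _; case: (_ \in _).
(* In [exceeding_pairs] the fixed a is the later position; [imv] sums over the earlier one first. *)
- rewrite exchange_big [RHS]big_mkcond; apply: eq_bigr => j _ /=.
  case: ifP => jE; last by apply: big1 => a _; rewrite andbF.
  by rewrite [RHS]big_mkcond; apply: eq_bigr => a _; case: (a \in E).
rewrite [RHS]big_mkcond; apply: eq_bigr => a _ /=; rewrite [a \in ~: _]in_setC.
case: ifP => aE; last by apply: big1.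
rewrite [RHS]big_mkcond; apply: eq_bigr => j _ /=; rewrite [j \in ~: _]in_setC.
by case: (j \in E).
Qed.

End Equidistribution.

(** * Block numbers and the trivial word *)

Lemma block_homo (eta : seq nat) (i j : nat) :
  (i <= j)%N -> (block eta i <= block eta j)%N.
Proof.
by rewrite (reshape_leq eta) /block ltnS => /orP[/ltnW//|/andP[/eqP-> _]].
Qed.

Lemma nth_idword (eta : seq nat) (i : nat) :
  (i < sumn eta)%N -> nth 0%N (idword eta) i = block eta i.
Proof.
move=> lt_i; rewrite /idword nth_flatten.
have -> : shape [seq nseq (nth 0 eta k) k.+1 | k <- iota 0 (size eta)]%N = eta.
  by rewrite /shape -map_comp -[RHS](mkseq_nth 0%N); apply: eq_map => k /=;
    rewrite size_nseq.
have lt_r := reshape_indexP lt_i.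
rewrite (nth_map 0%N) ?size_iota // nth_iota // add0n nth_nseq.
by have /= -> := reshape_offsetP lt_i.
Qed.

Lemma idwordE (n : nat) (eta : seq nat) :
  sumn eta = n -> idword eta = [seq block eta i | i : 'I_n <- enum 'I_n].
Proof.
move=> eta_n; have size_idword : size (idword eta) = n.
  rewrite size_flatten /shape -map_comp -[RHS]eta_n -[in RHS](mkseq_nth 0%N eta).
  by congr sumn; apply: eq_map => k /=; rewrite size_nseq.
apply: (@eq_from_nth _ 0%N); rewrite size_idword; first by rewrite size_map size_enum_ord.
move=> i lt_in; rewrite nth_idword ?eta_n // (nth_map (Ordinal lt_in))
   ?size_enum_ord //.
by rewrite nth_enum_ord.
Qed.

(** * The word of a permutation *)

Definition perm_word (n : nat) (eta : seq nat) (s : 'S_n) : seq nat :=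
  [seq block eta ((s^-1)%g j) | j <- enum 'I_n].

Lemma perm_eq_map_enum (T : finType) (s : {perm T}) :
  perm_eq [seq s i | i <- enum T] (enum T).
Proof.
apply: uniq_perm; rewrite ?enum_uniq //.
  by rewrite map_inj_uniq ?enum_uniq //; apply: perm_inj.
move=> i; rewrite mem_enum; apply/mapP; exists ((s^-1)%g i); rewrite ?mem_enum //.
by rewrite permKV.
Qed.

Section PermWord.

Variables (n : nat) (eta : seq nat).
Hypothesis eta_n : sumn eta = n.

Implicit Type s : 'S_n.

Lemma nth_perm_word s (j : 'I_n) :
  nth 0%N (perm_word n eta s) j = block eta ((s^-1)%g j).
Proof. by rewrite (nth_map j) ?size_enum_ord // nth_ord_enum. Qed.

Lemma perm_word_perm s : perm_eq (perm_word n eta s) (idword eta).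
Proof.
rewrite (idwordE n) // /perm_word (map_comp (fun i : 'I_n => block eta i)).
exact/perm_map/perm_eq_map_enum.
Qed.

(** An inversion of s^-1 inside one block would contradict admissibility, so comparing preimages
    amounts to comparing letters. *)
Lemma admissible_ltnV s (a j : 'I_n) : admissible eta s -> (a < j)%N ->
  ((s^-1)%g j < (s^-1)%g a)%N = (block eta ((s^-1)%g j) < block eta ((s^-1)%g a))%N.
Proof.
move=> /forallP adm lt_aj; apply/idP/idP; last first.
  by apply: contraTT; rewrite -!leqNgt; apply: block_homo.
move=> lt_t; rewrite ltn_neqAle block_homo ?(ltnW lt_t) // andbT.
apply: contraL lt_aj => eq_b; rewrite -leqNgt ltnW //.
have /forallP/(_ ((s^-1)%g a)) := adm ((s^-1)%g j).
by rewrite lt_t eq_b !permKV.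
Qed.

Lemma Exc_perm_word s : Exc n eta (perm_word n eta s) = Iset eta s.
Proof. by apply/setP => j; rewrite !inE nth_perm_word nth_idword ?eta_n. Qed.

Lemma exc_perm_word s : exc n eta (perm_word n eta s) = iexc eta s.
Proof. by rewrite /exc Exc_perm_word. Qed.

Lemma den_perm_word s : admissible eta s ->
  den eta s = (denH n eta (perm_word n eta s))%:Z.
Proof.
move=> adm; pose d (i : 'I_n) := block eta i; pose w j := d ((s^-1)%g j).
have d_homo (i j : 'I_n) : (i <= j)%N -> (d i <= d j)%N by apply: block_homo.
have eq_wd c : (\sum_j (w j < c) = \sum_j (d j < c))%N.
  by rewrite [RHS](reindex_inj (@perm_inj _ (s^-1)%g)).
have NplusE : #|Nplus eta s| =
    (\sum_(a < n) \sum_(j < n) [&& a < j, w a <= d j & w j < w a])%N.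
  rewrite (card_pairs _ _ (fun i j : 'I_n =>
    [&& block eta i <= block eta j, s i < j & (s^-1)%g j < i])%N).
  rewrite (reindex_inj (@perm_inj _ (s^-1)%g)); apply: eq_bigr => a _.
  apply: eq_bigr => j _; rewrite permKV andbCA.
  by case: ltnP => //= lt_aj; rewrite admissible_ltnV.
have NminusE : #|Nminus eta s| =
    (\sum_(a < n) \sum_(j < n) [&& a < j, d j < w a & w a <= w j])%N.
  rewrite (card_pairs _ _ (fun i j : 'I_n =>
    [&& block eta j < block eta i, s i < j & i < (s^-1)%g j])%N).
  rewrite (reindex_inj (@perm_inj _ (s^-1)%g)); apply: eq_bigr => a _.
  apply: eq_bigr => j _; rewrite permKV andbCA.
  case: ltnP => //= lt_aj; rewrite [(w a <= _)%N]leqNgt -admissible_ltnV //.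
  (* Since a and j differ, so do their preimages, and the weak inequality is strict. *)
  rewrite -leqNgt [X in _ && X]ltn_neqAle; suff -> : (s^-1)%g a != (s^-1)%g j :> nat by [].
  by rewrite (inj_eq val_inj) (inj_eq perm_inj) -(inj_eq val_inj) /= ltn_eqF.
rewrite /den NplusE NminusE (Nplus_decomposition _ w d d_homo eq_wd).
have pairsE (A : {set 'I_n}) (e : rel nat) (u := subword (perm_word n eta s) A) :
    #|[set p : 'I_(size u) * 'I_(size u) |
        (p.1 < p.2)%N && e (nth 0%N u p.1) (nth 0%N u p.2)]| =
    (\sum_(i in A) \sum_(j in A) ((i < j) && e (w i) (w j)))%N.
  rewrite card_subword_pairs; apply: eq_bigr => i _; apply: eq_bigr => j _.
  by rewrite !nth_perm_word.
rewrite /denH /imv /Defs.inv /excword /nexcword Exc_perm_word.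
rewrite (pairsE _ (fun k l => l <= k)%N) (pairsE _ (fun k l => l < k)%N).
have -> : [set i | d i < w i]%N = Iset eta s by apply/setP => i; rewrite !inE.
(* Here P is |N^-|, Q the number of excedances, X the [imv] term and Y the [inv] term. *)
have cancelE (S P Q X Y : nat) :
  S%:Z + (P + Q + X + Y)%N%:Z - P%:Z - Q%:Z = (S + X + Y)%N%:Z by lia.
exact: cancelE.
Qed.

(* The positions of w sorted by word_lex list the values of the inverse of the *)
(* standardization of w.                                                       *)
Definition word_lex (w : seq nat) : rel 'I_n := fun a b =>
  (nth 0 w a < nth 0 w b)%N || (nth 0%N w a == nth 0%N w b) && (a <= b)%N.

Lemma word_lex_total w : total (word_lex w).
Proof. by move=> a b; rewrite /word_lex; case: ltngtP => //= _; apply: leq_total. Qed.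

Lemma word_lex_trans w : transitive (word_lex w).
Proof.
move=> b a c; rewrite /word_lex; case: (ltngtP (nth 0%N w a)) => //= [lt_ab _|<-].
  case/orP=> [/(ltn_trans lt_ab)->//|/andP[/eqP<- _]]; by rewrite lt_ab.
move=> le_ab /orP[->//|/andP[-> /(leq_trans le_ab)->]]; by rewrite orbT.
Qed.

Lemma word_lex_anti w : antisymmetric (word_lex w).
Proof.
move=> a b; rewrite /word_lex.
by case: (ltngtP (nth 0%N w a)) => //= _ /anti_leq/val_inj.
Qed.

(** The letter at position [s i] is the block of i, so s is increasing for [word_lex]: across blocks
    by letters, within a block by admissibility. A total order has only one sorted listing. *)
Lemma admissible_sort s : admissible eta s ->
  [seq s i | i <- enum 'I_n] = sort (word_lex (perm_word n eta s)) (enum 'I_n).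
Proof.
move=> adm; set w := perm_word n eta s.
apply: (sorted_eq (word_lex_trans w) (@word_lex_anti w)); last 1 first.
- by rewrite perm_sym perm_sort perm_sym perm_eq_map_enum.
- rewrite sorted_map; apply: (@sub_sorted _ (relpre val ltn)); last first.
    by rewrite -sorted_map val_enum_ord iota_ltn_sorted.
  move=> i j /= lt_ij; rewrite /word_lex !nth_perm_word !permK.
  have := block_homo eta i j (ltnW lt_ij); rewrite leq_eqVlt orbC.
  case: ltnP => //= _ eq_b; rewrite eq_b ltnW //.
  by have /forallP/(_ i)/forallP/(_ j) := adm; rewrite lt_ij eq_b.
exact: sort_sorted (word_lex_total w) _.
Qed.

Lemma perm_word_inj : {in admissible eta &, injective (perm_word n eta)}.
Proof.
move=> s s' adm adm' eq_w; apply/permP => i.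
have := admissible_sort s adm; rewrite eq_w -admissible_sort //.
by move/eq_in_map => /(_ i); apply; rewrite mem_enum.
Qed.

(** The witness p lists the positions of w in [word_lex] order. Reading w along p gives a sorted
    rearrangement, hence the trivial word; ties broken by position make p admissible. *)
Lemma perm_word_surj (w : seq nat) : perm_eq w (idword eta) ->
  exists2 s, admissible eta s & perm_word n eta s = w.
Proof.
move=> perm_w; have size_w : size w = n.
  by rewrite (perm_size perm_w) (idwordE n) // size_map size_enum_ord.
have [p def_p] : exists p : 'S_n,
    sort (word_lex w) (enum 'I_n) = [seq p i | i <- enum 'I_n].
  have /tuple_permP[p ->] : perm_eq (sort (word_lex w) (enum 'I_n)) (ord_tuple n).
    by rewrite val_ord_tuple perm_sort.
  by exists p; apply: eq_map => i; rewrite tnth_ord_tuple.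
have sorted_p : sorted (relpre p (word_lex w)) (enum 'I_n).
  by rewrite -sorted_map -def_p; apply/sort_sorted/word_lex_total.
have lex_p (i j : 'I_n) : (i < j)%N -> word_lex w (p i) (p j).
  move=> lt_ij; have tr : transitive (relpre p (word_lex w)).
    by move=> ? ? ?; apply: word_lex_trans.
  have := sorted_ltn_nth tr i sorted_p; rewrite size_enum_ord => /(_ i j).
  by rewrite !inE !nth_ord_enum; apply.
have wpE : [seq nth 0%N w (p i) | i <- enum 'I_n] = idword eta.
  apply: (sorted_eq leq_trans anti_leq).
  - rewrite sorted_map; apply: sub_sorted sorted_p => i j /=.
    by rewrite /word_lex; case: ltngtP.
  - rewrite (idwordE n) // sorted_map; apply: (@sub_sorted _ (relpre val ltn)).
      by move=> i j /ltnW /=; apply: block_homo.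
    by rewrite -sorted_map val_enum_ord iota_ltn_sorted.
  rewrite -(permPr perm_w) -[X in perm_eq _ X](mkseq_nth 0%N) size_w /mkseq.
  rewrite -val_enum_ord -map_comp (map_comp (fun i : 'I_n => nth 0%N w i) p).
  by rewrite -def_p; apply: perm_map; rewrite perm_sort.
have wp i : nth 0%N w (p i) = block eta i.
  move: wpE; rewrite (idwordE n) // => /eq_in_map/(_ i); apply.
  by rewrite mem_enum.
exists p.
  apply/forallP => i; apply/forallP => j; apply/implyP => /andP[lt_ij /eqP eq_b].
  have := lex_p i j lt_ij; rewrite /word_lex !wp eq_b ltnn eqxx /=.
  by rewrite leq_eqVlt val_eqE (inj_eq perm_inj) -val_eqE (ltn_eqF lt_ij).
apply: (@eq_from_nth _ 0%N); rewrite size_map size_enum_ord // => i lt_in.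
by rewrite (nth_perm_word p (Ordinal lt_in)) -wp permKV.
Qed.

Lemma perm_eq_perm_words :
  perm_eq [seq perm_word n eta s | s <- enum (admissible eta : pred 'S_n)]
    (multiset_perms eta).
Proof.
apply: uniq_perm; rewrite ?permutations_uniq //.
  rewrite map_inj_in_uniq ?enum_uniq // => s s'; rewrite !mem_enum.
  exact: perm_word_inj.
move=> w; rewrite mem_permutations; apply/mapP/idP => [[s _ ->]|].
  exact: perm_word_perm.
by case/perm_word_surj => s adm <-; exists s; rewrite ?mem_enum.
Qed.

End PermWord.

Theorem theorem4p1 (n : nat) (eta : seq nat) (heta : is_composition n eta)
    (R : comUnitRingType) (x y : R) (hx : x \is a GRing.unit) :
  \sum_(s : 'S_n | admissible eta s) x ^ den eta s * y ^+ iexc eta s =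
  \sum_(w <- multiset_perms eta) x ^+ denH n eta w * y ^+ exc n eta w.
Proof.
have /andP[_ /eqP eta_n] := heta.
rewrite -(perm_big _ (perm_eq_perm_words n eta eta_n)) big_map big_enum.
(* [den] is now a natural number, so the integer power of x is an ordinary one. *)
by apply: eq_bigr => s adm; rewrite exc_perm_word // den_perm_word.
Qed.
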